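(* Let $\{F_n\}_{n\ge 0}$ be a natural numbers valued sequence with $F_0=1$ (the case $F_0=0$, as for the Fibonacci numbers, being allowed as exceptional), and let $\Pi$ be the cobweb poset designated by it. Let $x=\langle s,t\rangle$ and $y=\langle u,v\rangle$ be arbitrary elements of $\Pi$, where $s,u\in\mathbf{N}$, $t,v\in\mathbf{N}_0$, $1\le s\le F_t$ and $1\le u\le F_v$. Then the function $\zeta^2=\zeta\ast\zeta$ counts the elements of the segment $[x,y]=\{z\in\Pi: x\le z\le y\}$, i.e. $\zeta^2(x,y)=\mathrm{card}\,[x,y]$, and $$\mathrm{card}\,[x,y]=\left(\sum_{i=t+1}^{v-1}\sum_{j=1}^{F_i}1\right)+2=\left(\sum_{i=t+1}^{v-1}F_i\right)+2.$$
   Context: Cobweb poset: for $s\in\mathbf{N}_0=\mathbf{N}\cup\{0\}$ the $s$-th level is $\Phi_s=\{\langle j,s\rangle : 1\le j\le F_s\}$ (in the exceptional case $F_0=0$, level $\Phi_0$ corresponds to the empty root $\{\emptyset\}$, a single minimal element also written $\langle 1,0\rangle$). The cobweb poset is $\Pi=(V,\le)$ with $V=\bigcup_{s\ge 0}\Phi_s$ and $\langle s,t\rangle\le\langle u,v\rangle$ if and only if $t<v$, or $t=v$ and $s=u$. The zeta function of $\Pi$ is $\zeta(x,y)=1$ if $x\le y$ and $\zeta(x,y)=0$ otherwise; it is an element of the incidence algebra of $\Pi$ (the functions $f$ on $\Pi\times\Pi$ with $f(x,y)=0$ unless $x\le y$), whose product is $(f\ast g)(x,y)=\sum_{x\le z\le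 y}f(x,z)\,g(z,y)$.
   Formalization: The closed formula for card[x,y] is stated only for x < y rather than arbitrary x, y: for x = y the segment has 1 element and if x ≤ y fails it has 0, while the right-hand side is at least 2. *)

(* Defs.v *)
From HB Require Import structures.
From mathcomp Require Import all_boot all_order all_algebra.
From mathcomp Require Import finmap.
From mathcomp Require Import boolp classical_sets functions cardinality fsbigop.

Set Implicit Arguments.
Unset Strict Implicit.
Unset Printing Implicit Defensive.

Import Order.TTheory GRing.Theory.

Local Open Scope classical_set_scope.

(* In the exceptional case F 0 = 0 the level 0 is still a singleton: the root,
   written <1, 0>. *)
Definition level_size (F : nat -> nat) (s : nat) : nat :=
  if (s == 0) && (F 0 == 0) then 1 else F s.

(* The vertex <j, s>, with 1 <= j <= F_s, is encoded by the pair (j, s):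
   position first, level second. *)
Record cobweb (F : nat -> nat) := Cobweb {
  vertex :> nat * nat;
  _ : 0 < vertex.1 <= level_size F vertex.2
}.

HB.instance Definition _ F := [isSub for @vertex F].
HB.instance Definition _ F := [Countable of cobweb F by <:].

Definition cobweb_le F (x y : cobweb F) : bool :=
  (x.2 < y.2) || (x.2 == y.2) && (x.1 == y.1).

Fact cobweb_le_refl F : reflexive (@cobweb_le F).
Proof. by move=> x; rewrite /cobweb_le !eqxx orbT. Qed.

Fact cobweb_le_anti F : antisymmetric (@cobweb_le F).
Proof.
move=> x y; rewrite /cobweb_le => /andP[] /orP[xy|/andP[/eqP e2 /eqP e1] _].
  by case/orP=> [/(ltn_trans xy)|/andP[/eqP e _]]; rewrite ?e ltnn // in xy *.
by apply: val_inj; rewrite /= (surjective_pairing (vertex x)) e1 e2;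
   rewrite -surjective_pairing.
Qed.

Fact cobweb_le_trans F : transitive (@cobweb_le F).
Proof.
move=> y x z; rewrite /cobweb_le.
case/orP=> [xy|/andP[/eqP-> /eqP->]//].
by case/orP=> [/(ltn_trans xy)->//|/andP[/eqP<- _]]; rewrite xy.
Qed.

Fact cobweb_display : Order.disp_t. Proof. exact: Order.Disp tt tt. Qed.

HB.instance Definition _ F :=
  Order.Le_isPOrder.Build cobweb_display (cobweb F)
    (@cobweb_le_refl F) (@cobweb_le_anti F) (@cobweb_le_trans F).

Lemma cobweb_leE F (x y : cobweb F) : (x <= y)%O = cobweb_le x y.
Proof. by []. Qed.

Definition segment d (P : porderType d) (x y : P) : set P :=
  [set z | (x <= z <= y)%O].

(* Local finiteness: the (finitely supported) sum defining the product below
   and the cardinal of a segment are therefore the genuine ones on a cobweb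
   poset. *)
Lemma cobweb_segment_finite F (x y : cobweb F) : finite_set (segment x y).
Proof.
pose M := \sum_(i < y.2.+1) level_size F i.
have fB : finite_set (`I_M.+1 `*` `I_y.2.+1) by exact: finite_setX.
have inj : set_inj (segment x y) (@vertex F) by move=> ? ? _ _; exact: val_inj.
rewrite -(eq_finite_set (inj_card_eq inj)).
apply: sub_finite_set fB => _ [z /andP[_ zy] <-].
have z2 : z.2 < y.2.+1.
  by case/orP: zy => [/ltnW //|/andP[/eqP-> _]]; rewrite ltnS.
split=> //=; rewrite ltnS.
case: z z2 {zy} => -[j s] /= /andP[_ js] sy; apply: leq_trans js _.
by rewrite /M (bigD1 (Ordinal sy)) //= leq_addr.
Qed.

Record incidence d (P : porderType d) (R : comNzRingType) := Incidence {
  incidence_fun :> P -> P -> R;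
  incidenceP : forall x y, ~~ (x <= y)%O -> incidence_fun x y = 0%R
}.

Section IncidenceAlgebra.
Context d (P : porderType d) (R : comNzRingType).
Local Open Scope ring_scope.

Definition convolution (f g : P -> P -> R) (x y : P) : R :=
  \sum_(z \in segment x y) f x z * g z y.

Fact incidence_mul_subproof (f g : incidence P R) x y :
  ~~ (x <= y)%O -> convolution f g x y = 0.
Proof.
move=> xy; rewrite /convolution fsbig1 // => z /andP[xz zy].
by rewrite (le_trans xz zy) in xy.
Qed.

Definition incidence_mul (f g : incidence P R) : incidence P R :=
  Incidence (@incidence_mul_subproof f g).

Fact zeta_subproof (x y : P) :
  ~~ (x <= y)%O -> (if (x <= y)%O then 1 else 0) = 0 :> R.
Proof. by move=> /negbTE->. Qed.

Definition zeta : incidence P R := Incidence zeta_subproof.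

End IncidenceAlgebra.
Arguments zeta {d} P R.

Definition card_segment d (P : porderType d) (x y : P) : nat :=
  #|` fset_set (segment x y)|.

(* Main.v *)
Require Import Defs.
From mathcomp Require Import all_boot all_order all_algebra.
From mathcomp Require Import finmap.
From mathcomp Require Import classical_sets cardinality fsbigop.

Import Order.TTheory GRing.Theory.

(** On a segment both zeta factors equal 1, so the convolution adds one 1 per element
    ([zeta_square_card]). If [x < y], the segment consists of the two distinct endpoints and of all
    vertices on the levels strictly between theirs, since the order between different levels depends
    on the levels alone; counting these level by level gives [card_segment_cobweb]. The inner sums
    of ones collapse to [F i]. *)

Lemma zeta_square_card d (P : porderType d) (R : comNzRingType) (x y : P) :
  finite_set (segment x y) ->
  incidence_mul (zeta P R) (zeta P R) x y = ((card_segment x y)%:R)%R.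
Proof.
move=> fin_xy; rewrite /= /convolution fsbig_finite //=.
rewrite /card_segment -sum1_size natr_sum big_seq [RHS]big_seq.
apply: eq_bigr => z; rewrite in_fset_set // inE => /andP[xz zy].
by rewrite xz zy mulr1.
Qed.

(** Raw pairs bounded by [F], without membership proofs, let the size be read off directly as a sum
    of [F i]. *)
Definition strict_interior (F : nat -> nat) (t v : nat) : seq (nat * nat) :=
  [seq (j, i) | i <- index_iota t.+1 v, j <- index_iota 1 (F i).+1].

Lemma mem_strict_interior F t v (p : nat * nat) :
  (p \in strict_interior F t v) = (t < p.2 < v) && (0 < p.1 <= F p.2).
Proof.
apply/allpairsPdep/idP => [[i [j [+ + ->]]]|/andP[ht hj]].
  by rewrite !mem_index_iota /= ltnS => -> ->.
by exists p.2, p.1; rewrite !mem_index_iota ltnS; split => //; case: p {ht hj}.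
Qed.

Lemma strict_interior_uniq F t v : uniq (strict_interior F t v).
Proof.
apply: allpairs_uniq_dep => [|i _|]; rewrite ?iota_uniq //.
by move=> [i j] [i' j'] _ _ /= [-> ->].
Qed.

Lemma size_strict_interior F t v :
  size (strict_interior F t v) = \sum_(t.+1 <= i < v) F i.
Proof.
rewrite size_allpairs_dep sumnE big_map.
by apply: eq_bigr => i _; rewrite size_iota subn1.
Qed.

(** Vertices on one level are comparable only when equal. *)
Lemma cobweb_ltE F (x y : cobweb F) :
  (x < y)%O = ((vertex x).2 < (vertex y).2).
Proof.
rewrite lt_neqAle cobweb_leE /cobweb_le -val_eqE /=.
case: (vertex x) (vertex y) => [s t] [u v] /=; rewrite xpair_eqE.
by case: ltngtP => _; rewrite ?andbT ?andbF //; case: eqP.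
Qed.

Lemma card_segment_cobweb F (x y : cobweb F) : (x < y)%O ->
  card_segment x y = \sum_((vertex x).2.+1 <= i < (vertex y).2) F i + 2.
Proof.
move=> lt_xy; pose I := strict_interior F (vertex x).2 (vertex y).2.
(* The 2 stands for the endpoints, put in front of [I]; it remains to match two duplicate-free lists
   of pairs by membership. *)
rewrite addn2 -size_strict_interior -/(size [:: vertex x, vertex y & I]).
rewrite /card_segment -(size_map (@vertex F)); apply/perm_size/uniq_perm.
- by rewrite map_inj_uniq ?fset_uniq //; exact: val_inj.
(* The strict level bounds keep both endpoints out of [I], and [x < y] makes them distinct. *)
- rewrite /= inE !mem_strict_interior !ltnn andbF strict_interior_uniq orbF.
  by rewrite !andbT; move: (lt_eqF lt_xy); rewrite -val_eqE /= => ->.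
have fin_xy := cobweb_segment_finite x y.
(* No level strictly between two others is the root level, where [level_size]
   and [F] may differ. *)
have level_sizeE n m : n < m -> level_size F m = F m by case: m.
move=> p; rewrite !inE mem_strict_interior; apply/mapP/idP.
  move=> [z]; rewrite in_fset_set // inE => /andP[xz zy] ->.
  move: xz; rewrite le_eqVlt => /orP[/eqP->|xz]; first by rewrite eqxx.
  move: zy; rewrite le_eqVlt => /orP[/eqP->|zy]; first by rewrite eqxx orbT.
  rewrite !cobweb_ltE in xz zy; rewrite xz zy -(level_sizeE _ _ xz).
  by case: (z) => q /= ->; rewrite !orbT.
have mem_fset z : (x <= z)%O -> (z <= y)%O -> z \in fset_set (segment x y).
  by move=> xz zy; rewrite in_fset_set // inE; apply/andP.
case/or3P => [/eqP->|/eqP->|/andP[/andP[xp py]]].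
- by exists x; rewrite // mem_fset // ltW.
- by exists y; rewrite // mem_fset // ltW.
(* With [F] turned into [level_size], the bound is exactly the proof that makes [p] a vertex. *)
rewrite -(level_sizeE _ _ xp) => hp; exists (Cobweb hp) => //.
by apply: mem_fset; apply: ltW; rewrite cobweb_ltE.
Qed.

Theorem mainTheorem3 (R : comNzRingType) (F : nat -> nat)
    (hF0 : F 0 = 1 \/ F 0 = 0) (hF : forall n : nat, 0 < n -> 0 < F n)
    (x y : cobweb F) (s t u v : nat)
    (hx : vertex x = (s, t)) (hy : vertex y = (u, v)) :
  incidence_mul (zeta (cobweb F) R) (zeta (cobweb F) R) x y
    = ((card_segment x y)%:R)%R
  /\ ((x < y)%O ->
      card_segment x y
        = (\sum_(t.+1 <= i < v) \sum_(1 <= j < (F i).+1) 1) + 2)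
  /\ (\sum_(t.+1 <= i < v) \sum_(1 <= j < (F i).+1) 1) + 2
      = (\sum_(t.+1 <= i < v) F i) + 2.
Proof.
have sumF : \sum_(t.+1 <= i < v) \sum_(1 <= j < (F i).+1) 1
            = \sum_(t.+1 <= i < v) F i.
  by apply: eq_bigr => i _; rewrite sum_nat_const_nat subn1 muln1.
split; first exact/zeta_square_card/cobweb_segment_finite.
by rewrite sumF; split=> // /card_segment_cobweb; rewrite hx hy.
Qed.
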